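(* Let $\mathcal{M}$ be an arbitrary variety of groups and $\mathcal{A}$ the variety of abelian groups. (1) Let $G\in\mathcal{M}$ be a countable group such that the abelianization $G_{ab}$ is a direct product of a free abelian group and a finite group. Then $G$ embeds in a $4$-generated group $H\in\mathcal{M}\mathcal{A}$. In particular, every finitely generated group $G\in\mathcal{M}$ embeds in some $4$-generated group $H\in\mathcal{M}\mathcal{A}$. (2) Let $G$ be a countable solvable group of derived length $l$ such that the abelianization $G_{ab}$ is a direct product of a free abelian group and a finite group. Then $G$ embeds in a $4$-generated solvable group $H$ of derived length $l+1$. In particular, every finitely generated solvable group $G$ of derived length $l$ embeds in some $4$-generated solvable group $H$ of derived length $l+1$.
   Context: Countable means finite or countably infinite. $G_{ab}=G/G'$, where $G'$ is the derived subgroup of $G$. A group is $k$-generated if it can be generated by $k$ elements (not necessarily distinct). For varieties of groups $\mathcal{M}$ and $\mathcal{N}$, the product variety $\mathcal{M}\mathcal{N}$ consists of all groups $H$ having a normal subgroup $N\in\mathcal{M}$ with $H/N\in\mathcal{N}$. *)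

(* Defs.v *)
From HB Require Import structures.
From mathcomp Require Import all_boot all_algebra.
From mathcomp Require Import boolp classical_sets cardinality.
From mathcomp Require Import freeg.

Set Implicit Arguments.
Unset Strict Implicit.
Unset Printing Implicit Defensive.

Local Open Scope classical_set_scope.
Local Open Scope group_scope.

(* Groups are [groupType]s, whose carriers may be infinite; sets are classical
   sets, and membership in them is turned into a boolean by [asbool]. *)

Definition is_subgroup (G : groupType) (A : set G) : Prop :=
  group_closed [in A].

Definition generated (G : groupType) (A : set G) : set G :=
  smallest (@is_subgroup G) A.

Definition k_generated (k : nat) (G : groupType) : Prop :=
  exists s : 'I_k -> G, generated (range s) = [set: G].

Definition finitely_generated (G : groupType) : Prop :=
  exists k, k_generated k G.

Definition embeds (G H : groupType) : Prop :=
  exists f : {multiplicative G -> H}, injective f.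

Definition isomorphic (G H : groupType) : Prop :=
  exists f : {multiplicative G -> H}, bijective f.

Record normal_subgroup (G : groupType) := NormalSubgroup {
  nsubg_set :> set G;
  nsubg_group : is_subgroup nsubg_set;
  nsubg_conj : forall x y : G, nsubg_set x -> nsubg_set (x ^ y)
}.

Record nsubg_type (G : groupType) (N : normal_subgroup G) := NsubgElt {
  nsubg_val :> G;
  nsubg_valP : nsubg_val \in nsubg_set N
}.

HB.instance Definition _ (G : groupType) (N : normal_subgroup G) :=
  [isSub for @nsubg_val G N].
HB.instance Definition _ (G : groupType) (N : normal_subgroup G) :=
  [Choice of nsubg_type N by <:].
HB.instance Definition _ (G : groupType) (N : normal_subgroup G) :=
  SubChoice_isSubGroup.Build G _ (nsubg_type N) (nsubg_group N).

Section Quotient.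
Context (G : groupType) (N : normal_subgroup G).

(* x and y are related when x N = y N. *)
Definition coset_rel : rel G := fun x y => x^-1 * y \in nsubg_set N.

Lemma nsubg1 : 1 \in nsubg_set N.
Proof. exact: (nsubg_group N).1. Qed.

Lemma nsubgM x y :
  x \in nsubg_set N -> y \in nsubg_set N -> x * y \in nsubg_set N.
Proof. exact: (group_closedM (nsubg_group N)). Qed.

Lemma nsubgV x : x \in nsubg_set N -> x^-1 \in nsubg_set N.
Proof. exact: (group_closedV (nsubg_group N)). Qed.

Lemma nsubgJ x y : x \in nsubg_set N -> x ^ y \in nsubg_set N.
Proof. by move=> /set_mem xN; apply/mem_set/nsubg_conj. Qed.

Lemma coset_rel_refl : reflexive coset_rel.
Proof. by move=> x; rewrite /coset_rel mulVg nsubg1. Qed.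

Lemma coset_rel_sym : symmetric coset_rel.
Proof.
by move=> x y; apply/idP/idP => /nsubgV; rewrite /coset_rel invgM invgK.
Qed.

Lemma coset_rel_trans : transitive coset_rel.
Proof.
move=> y x z xy yz; have := nsubgM xy yz.
by rewrite /coset_rel -mulgA mulVKg.
Qed.

Canonical coset_equiv := EquivRel coset_rel
  coset_rel_refl coset_rel_sym coset_rel_trans.

Definition quotient_type : Type := {eq_quot coset_rel}%qT.

HB.instance Definition _ := Choice.on quotient_type.
HB.instance Definition _ := Quotient.on quotient_type.

Local Notation cls := (\pi_(quotient_type) : G -> quotient_type)%qT.

Definition quo_one : quotient_type := cls 1.
Definition quo_mul (u v : quotient_type) : quotient_type :=
  cls (repr u * repr v).
Definition quo_inv (u : quotient_type) : quotient_type := cls (repr u)^-1.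

Lemma eq_cls x y : cls x = cls y <-> coset_rel x y.
Proof. by split=> [/eqmodP | h]; last exact/eqmodP. Qed.

Lemma coset_rel_repr x : coset_rel (repr (cls x)) x.
Proof. by apply/eq_cls; rewrite reprK. Qed.

Lemma quo_mulE x y : quo_mul (cls x) (cls y) = cls (x * y).
Proof.
apply/eq_cls; have := coset_rel_repr x; have := coset_rel_repr y.
rewrite /coset_rel; move: (repr _) (repr _) => y' x' hy hx.
have := nsubgM hy (nsubgJ y hx).
by rewrite /conjg invgM !mulgA mulgK.
Qed.

Lemma quo_invE x : quo_inv (cls x) = cls x^-1.
Proof.
apply/eq_cls; have := coset_rel_repr x.
rewrite /coset_rel; move: (repr _) => x' hx.
have := nsubgJ x^-1 (nsubgV hx).
by rewrite /conjg invgM !invgK !mulgA mulgV mul1g.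
Qed.

Lemma cls_surj u : exists x, u = cls x.
Proof. by exists (repr u); rewrite reprK. Qed.

Lemma quo_mulA : associative quo_mul.
Proof.
move=> u v w; have [x ->] := cls_surj u.
have [y ->] := cls_surj v; have [z ->] := cls_surj w.
by rewrite !quo_mulE mulgA.
Qed.

Lemma quo_mul1 : left_id quo_one quo_mul.
Proof. by move=> u; have [x ->] := cls_surj u; rewrite quo_mulE mul1g. Qed.

Lemma quo_mulr1 : right_id quo_one quo_mul.
Proof. by move=> u; have [x ->] := cls_surj u; rewrite quo_mulE mulg1. Qed.

Lemma quo_mulV : left_inverse quo_one quo_inv quo_mul.
Proof.
by move=> u; have [x ->] := cls_surj u; rewrite quo_invE quo_mulE mulVg.
Qed.

Lemma quo_mulrV : right_inverse quo_one quo_inv quo_mul.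
Proof.
by move=> u; have [x ->] := cls_surj u; rewrite quo_invE quo_mulE mulgV.
Qed.

HB.instance Definition _ := isGroup.Build quotient_type
  quo_mulA quo_mul1 quo_mulr1 quo_mulV quo_mulrV.

End Quotient.

(* A word in the letters x_0, x_1, ... and their inverses: (i, false) stands for
   x_i and (i, true) for x_i^-1. *)
Definition word : Type := seq (nat * bool).

Definition eval_word (G : groupType) (v : nat -> G) (w : word) : G :=
  \prod_(p <- w) (if p.2 then (v p.1)^-1 else v p.1).

Definition law (G : groupType) (w : word) : Prop :=
  forall v : nat -> G, eval_word v w = 1.

(* A variety is the class of all groups satisfying some set of laws. *)
Definition variety (M : groupType -> Prop) : Prop :=
  exists W : set word, forall G, M G <-> (forall w, W w -> law G w).

Definition abelian_groups (G : groupType) : Prop :=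
  forall x y : G, x * y = y * x.

Definition product_variety (M N : groupType -> Prop) (H : groupType) : Prop :=
  exists K : normal_subgroup H, M (nsubg_type K) /\ N (quotient_type K).

Definition derived (G : groupType) (A : set G) : set G :=
  generated [set [~ x, y] | x in A & y in A].

Definition derived_series (G : groupType) (n : nat) : set G :=
  iter n (@derived G) [set: G].
Arguments derived_series : clear implicits.

(* l is the exact derived length: the least index at which the derived series is
   trivial. The trivial group has derived length 0. *)
Definition solvable_of_length (l : nat) (G : groupType) : Prop :=
  derived_series G l = [set 1] /\
  forall m, (m < l)%N -> derived_series G m <> [set 1].

Lemma derived_group (G : groupType) : is_subgroup (derived [set: G]).
Proof.
split; first by apply/mem_set => A [[A1 _] _]; exact/set_mem.
move=> x y /set_mem xD /set_mem yD; apply/mem_set => A AP; apply: set_mem.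
by apply: (AP.1.2); apply/mem_set; [exact: xD | exact: yD].
Qed.

Lemma derived_conj (G : groupType) (x y : G) :
  derived [set: G] x -> derived [set: G] (x ^ y).
Proof.
move=> xD; have -> : x ^ y = x * [~ x, y] by rewrite /commg mulVKg.
apply/set_mem/(group_closedM (derived_group G)); first exact/mem_set.
by apply/mem_set => A [_]; apply; exists x => //; exists y.
Qed.

Definition derived_subgroup (G : groupType) : normal_subgroup G :=
  NormalSubgroup (derived_group G) (@derived_conj G).

Definition abelianization (G : groupType) : groupType :=
  quotient_type (derived_subgroup G).

(* {freeg B / int} is the additive group of finitely supported functions B -> int,
   i.e. the direct sum of copies of Z indexed by the basis B, which is arbitrary. *)
Definition free_abelian (F : groupType) : Prop :=
  exists B : choiceType,
    isomorphic F (Algebra.to_multiplicative {freeg B / int}).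

Definition free_abelian_times_finite (A : groupType) : Prop :=
  exists F K : groupType,
    [/\ free_abelian F, finite_set [set: K] & isomorphic A (F * K)%type].

(* Main.v *)
Require Import Defs.
From HB Require Import structures.
From mathcomp Require Import all_boot all_algebra.
From mathcomp Require Import boolp classical_sets cardinality.
From mathcomp Require Import freeg zify.

Set Implicit Arguments.
Unset Strict Implicit.
Unset Printing Implicit Defensive.

Import GRing.Theory Num.Theory.

Local Open Scope classical_set_scope.
Local Open Scope group_scope.

(** The group H is found inside the unrestricted wreath product of G and Z^3: it
is generated by the three unit translations of Z^3 and by one function
Z^3 -> G, the tape. Such an H lies in M A if G lies in M, and has derived
length at most l + 1 if G has derived length l, because the functions in H
form a normal subgroup with abelian quotient, and the values of functions at a
point give homomorphisms from that subgroup to G. So everything rests on the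
choice of the tape.

The hypothesis on G is used in the form [ab_split]: there are elements b_i of G
with coordinate homomorphisms c_i : G -> Z, c_i (b_j) = 1 if i = j and 0
otherwise, and finitely many t_1, ..., t_k with a power in G', such that G is
generated by G', the b_i and the t_j. When G_ab is free abelian times finite one
lifts a basis of the free factor and all elements of the finite factor
([free_times_finite_ab_split]). When G is finitely generated one starts from any
generators: as long as they satisfy a nontrivial relation modulo G', a
unimodular change of generators, given by the Smith normal form, makes one of
them torsion modulo G'; generators without relation have coordinates
([finitely_generated_ab_split]).

Write the points of Z^3 as (n, p), with n in Z the layer and p in Z^2. The tape
consists of countably many fillings u_x : Z^2 -> G, placed on layers a_x chosen
so that a nonzero difference a_y - a_x determines x and y. After translation by
a_x the tape shows u_x on layer 0, and two different translates of this kind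
have only layer 0 in their common support. The copy of g in H is the function
equal to g on all of layer 0, to u_y ^ (c_i g) on layer a_y - a_x when x is the
index of the filling with constant value b_i, and to 1 elsewhere. It depends
multiplicatively on g, and the copy of b_i is a translate of the tape. Elements
with all coordinates zero live on layer 0 only, and the other two kinds of
fillings serve to reach them.

- For every g in G there is a filling equal to g on the lattice (N Z)^2 and to 1
  off it. Commutators of translates of the tape give every commutator, hence
  every element of G', on the lattice in layer 0; products of translates then
  give all N-periodic functions from layer 0 to G' ([periodic_in]), the
  constants among them.

- One last filling takes care of all t_j at once, and this is what bounds the
  number of generators. Let e be a common exponent of the t_j modulo G',
  N = e^k, and let w (l, m) be the product of the t_j over those j with e^j | l
  and e^(k-j) | m. The filling (l, m) |-> w (l, m) ^ floor (l / N) changes by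
  the factor w under translation by N along the first axis, while all other
  fillings are invariant, so H contains w on layer 0 ([pattern_in]). A box with
  sides e^i and e^(k-i) contains exactly one point of the i-th sublattice used
  in w, and a number of points divisible by e of each other one. Hence
  multiplying the translates of w over that box gives t_i modulo G'
  ([ab_box]); the error is N-periodic, thus already in H.

For the exact derived length, 1 is arranged not to be a difference of two
layers. The commutator of the copy of g^-1 with the unit translation between
layers then takes the value g at the origin, so the derived subgroup of H maps
onto G. *)

(** * Subgroups, homomorphisms and integer powers *)

Section Subgroups.
Context (G : groupType).
Implicit Types (A B : set G) (x y : G).

Lemma subgroupP A :
  is_subgroup A <-> A 1 /\ (forall x y, A x -> A y -> A (x * y^-1)).
Proof.
split=> [[A1 AF]|[A1 AF]]; split.
- by apply/set_mem.
- by move=> x y Ax Ay; apply/set_mem/AF; apply/mem_set.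
- exact/mem_set.
- by move=> x y /set_mem Ax /set_mem Ay; apply/mem_set/AF.
Qed.

Lemma subgroup1 A : is_subgroup A -> A 1.
Proof. by case/subgroupP. Qed.

Lemma subgroupV A x : is_subgroup A -> A x -> A x^-1.
Proof. by case/subgroupP=> A1 AF Ax; rewrite -div1g; apply: AF. Qed.

Lemma subgroupM A x y : is_subgroup A -> A x -> A y -> A (x * y).
Proof.
move=> gA Ax Ay; rewrite -[y]invgK.
by case/subgroupP: (gA) => _; apply=> //; apply: subgroupV.
Qed.

Lemma subgroupJ A x y : is_subgroup A -> A x -> A y -> A (x ^ y).
Proof. by move=> gA Ax Ay; do !apply: subgroupM => //; apply: subgroupV. Qed.

Lemma subgroupR A x y : is_subgroup A -> A x -> A y -> A [~ x, y].
Proof.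
move=> gA Ax Ay; apply: subgroupM => //; first exact: subgroupV.
exact: subgroupJ.
Qed.

Lemma subgroup_prod A I (r : seq I) (P : pred I) (F : I -> G) :
  is_subgroup A -> (forall i, P i -> A (F i)) -> A (\prod_(i <- r | P i) F i).
Proof.
move=> gA AF; elim/big_ind: _ => //; first exact: subgroup1.
by move=> x y; apply: subgroupM.
Qed.

Lemma generated_subgroup A : is_subgroup (generated A).
Proof.
apply/subgroupP; split=> [B [gB _]|x y Ax Ay B BA]; first exact: subgroup1.
by case/subgroupP: BA.1 => _; apply; [apply: Ax | apply: Ay].
Qed.

Lemma sub_generated A : A `<=` generated A.
Proof. by move=> x Ax B [_]; apply. Qed.

Lemma generated_min A B : is_subgroup B -> A `<=` B -> generated A `<=` B.
Proof. by move=> gB AB x; apply. Qed.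

Lemma setT_subgroup : is_subgroup [set: G].
Proof. exact/subgroupP. Qed.

Lemma derivedR A x y : A x -> A y -> derived A [~ x, y].
Proof. by move=> Ax Ay; apply: sub_generated; exists x => //; exists y. Qed.

Lemma derived_min A B : is_subgroup B ->
  (forall x y, A x -> A y -> B [~ x, y]) -> derived A `<=` B.
Proof.
by move=> gB AB; apply: generated_min => // _ [x Ax [y Ay <-]]; apply: AB.
Qed.

Lemma derived_series_subgroup n : is_subgroup (derived_series G n).
Proof.
by case: n => [|n]; [apply: setT_subgroup | apply: generated_subgroup].
Qed.

Lemma derived_series1 n : derived_series G n 1.
Proof. exact: subgroup1 (derived_series_subgroup n). Qed.

Lemma derived_series_min n B : is_subgroup B ->
  (forall x y, derived_series G n x -> derived_series G n y -> B [~ x, y]) ->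
  forall x, derived_series G n.+1 x -> B x.
Proof. exact: derived_min. Qed.

End Subgroups.

Record subgroup_type (G : groupType) (A : set G) (gA : is_subgroup A) :=
  SubgroupElt { subgroup_val :> G; subgroup_valP : subgroup_val \in A }.

HB.instance Definition _ (G : groupType) (A : set G) (gA : is_subgroup A) :=
  [isSub for @subgroup_val G A gA].
HB.instance Definition _ (G : groupType) (A : set G) (gA : is_subgroup A) :=
  [Choice of subgroup_type gA by <:].
HB.instance Definition _ (G : groupType) (A : set G) (gA : is_subgroup A) :=
  SubChoice_isSubGroup.Build G _ (subgroup_type gA) gA.

Section Morphisms.

(** A predicate on bare functions: the homomorphisms below are built from
explicit formulas, and most are used only to transport subgroups. *)
Definition mulmorph (G H : groupType) (f : G -> H) : Prop :=
  forall x y, f (x * y) = f x * f y.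

Context (G H : groupType) (f : G -> H) (fM : mulmorph f).

Lemma mulmorph1 : f 1 = 1.
Proof. by apply: (@mulgI _ (f 1)); rewrite -fM !mulg1. Qed.

Lemma mulmorphV x : f x^-1 = (f x)^-1.
Proof. by apply: (@mulgI _ (f x)); rewrite -fM !mulgV mulmorph1. Qed.

Lemma mulmorphR x y : f [~ x, y] = [~ f x, f y].
Proof. by rewrite !fM !mulmorphV. Qed.

Lemma mulmorphX x n : f (x ^+ n) = f x ^+ n.
Proof. by elim: n => [|n IHn]; rewrite ?mulmorph1 // !expgS fM IHn. Qed.

Lemma mulmorph_prod I (r : seq I) (P : pred I) (F : I -> G) :
  f (\prod_(i <- r | P i) F i) = \prod_(i <- r | P i) f (F i).
Proof. exact: (big_morph f fM mulmorph1). Qed.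

Lemma preimage_subgroup (B : set H) : is_subgroup B -> is_subgroup (f @^-1` B).
Proof.
move=> gB; apply/subgroupP; split=> [|x y /= Bx By].
  by rewrite /preimage /= mulmorph1; apply: subgroup1.
by rewrite fM mulmorphV; apply: subgroupM => //; apply: subgroupV.
Qed.

Lemma image_subgroup (A : set G) : is_subgroup A -> is_subgroup (f @` A).
Proof.
move=> gA; apply/subgroupP; split.
  by exists 1; [apply: subgroup1 | apply: mulmorph1].
move=> _ _ [x Ax <-] [y Ay <-]; exists (x * y^-1); last by rewrite fM mulmorphV.
by apply: subgroupM => //; apply: subgroupV.
Qed.

End Morphisms.

Lemma k_generated_subgroup (G : groupType) k (s : 'I_k -> G) :
  k_generated k (subgroup_type (generated_subgroup (range s))).
Proof.
set gS := generated_subgroup _.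
have sS i : s i \in generated (range s).
  by apply/mem_set; apply: sub_generated; exists i.
exists (fun i => SubgroupElt gS (sS i)); apply/seteqP; split=> // x _.
set A := generated _.
have vM : mulmorph (val : subgroup_type gS -> G) by exact: valM.
have gA : is_subgroup (val @` A).
  by apply: image_subgroup => //; apply: generated_subgroup.
have sA : range s `<=` val @` A.
  move=> _ [i _ <-]; exists (SubgroupElt gS (sS i)) => //.
  by apply: sub_generated; exists i.
have /set_mem/(generated_min gA sA)[y Ay /val_inj <- //] :
  val x \in generated (range s) by exact: valP.
Qed.

Section IntegerPowers.
Context (G : groupType).
Implicit Types x : G.

Definition expz x (z : int) : G :=
  match z with Posz n => x ^+ n | Negz n => x ^- n.+1 end.

Lemma expzS x z : expz x (z + 1)%R = expz x z * x.
Proof.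
case: z => [n|[|n]]; first by rewrite /= addn1 expgSr.
  by rewrite /= mulVg.
have -> : (Negz n.+1 + 1)%R = Negz n by lia.
by rewrite /= (expgS x n.+1) invgM mulgVK.
Qed.

Lemma expzD x y z : expz x (y + z)%R = expz x y * expz x z.
Proof.
elim/int_rect: z => [|n IHn|n IHn]; first by rewrite addr0 mulg1.
  have -> : (n.+1 : int) = (n%:Z + 1)%R by lia.
  by rewrite addrA !expzS IHn mulgA.
apply: (@mulIg _ x); rewrite -mulgA -!expzS -addrA.
by have -> : (- n.+1%:Z + 1)%R = (- n%:Z)%R by lia.
Qed.

End IntegerPowers.

(** * The unrestricted wreath product with an additive group *)

Definition wreath (V : zmodType) (G : groupType) : Type := (V * (V -> G))%type.

Section Wreath.
Context (V : zmodType) (G : groupType).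
Implicit Types (a b : wreath V G) (u : V -> G) (v w : V).

HB.instance Definition _ := Choice.on (wreath V G).

Definition wr_mul a b : wreath V G :=
  ((a.1 + b.1)%R, fun x => a.2 x * b.2 (x + a.1)%R).
Definition wr_one : wreath V G := (0%R, fun=> 1).
Definition wr_inv a : wreath V G := ((- a.1)%R, fun x => (a.2 (x - a.1)%R)^-1).

Lemma wr_mulA : associative wr_mul.
Proof.
move=> a b c; congr pair; first exact: addrA.
by apply/funext => x /=; rewrite mulgA addrA.
Qed.

Lemma wr_mul1g : left_id wr_one wr_mul.
Proof.
case=> v f; congr pair; first exact: add0r.
by apply/funext => x /=; rewrite mul1g addr0.
Qed.

Lemma wr_mulg1 : right_id wr_one wr_mul.
Proof.
case=> v f; congr pair; first exact: addr0.
by apply/funext => x /=; rewrite mulg1.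
Qed.

Lemma wr_mulVg : left_inverse wr_one wr_inv wr_mul.
Proof.
case=> v f; congr pair; first exact: addNr.
by apply/funext => x /=; rewrite mulVg.
Qed.

Lemma wr_mulgV : right_inverse wr_one wr_inv wr_mul.
Proof.
case=> v f; congr pair; first exact: addrN.
by apply/funext => x /=; rewrite addrK mulgV.
Qed.

HB.instance Definition _ := isGroup.Build (wreath V G)
  wr_mulA wr_mul1g wr_mulg1 wr_mulVg wr_mulgV.

Definition wr_base u : wreath V G := (0%R, u).
Definition wr_shift (v : V) : wreath V G := (v, fun=> 1).

Lemma wr_baseM u u' : wr_base u * wr_base u' = wr_base (fun x => u x * u' x).
Proof.
congr pair; first exact: addr0.
by apply/funext => x /=; rewrite addr0.
Qed.

Lemma wr_baseV u : (wr_base u)^-1 = wr_base (fun x => (u x)^-1).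
Proof.
congr pair; first exact: oppr0.
by apply/funext => x /=; rewrite subr0.
Qed.

Lemma wr_baseR u u' :
  [~ wr_base u, wr_base u'] = wr_base (fun x => [~ u x, u' x]).
Proof. by rewrite /commg /conjg !wr_baseV !wr_baseM. Qed.

Lemma wr_shiftM v w : wr_shift v * wr_shift w = wr_shift (v + w)%R.
Proof. by congr pair; apply/funext => x /=; rewrite mulg1. Qed.

Lemma wr_shiftV v : (wr_shift v)^-1 = wr_shift (- v)%R.
Proof. by congr pair; apply/funext => x /=; rewrite invg1. Qed.

Lemma wr_baseJ u v :
  wr_base u ^ wr_shift (- v)%R = wr_base (fun x => u (x + v)%R).
Proof.
rewrite /conjg wr_shiftV opprK; congr pair.
  by rewrite /= add0r subrr.
by apply/funext => x; rewrite /= mul1g mulg1.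
Qed.

Lemma wr_commg1 a b : [~ a, b].1 = 0%R.
Proof.
rewrite /=; set v := a.1; set w := b.1.
by rewrite (addrC v w) addKr addNr.
Qed.

(** The first derived subgroup already consists of functions; from then on
commutators are computed value by value. *)
Lemma derived_series_wreath n a :
  derived_series (wreath V G) n.+1 a ->
  a.1 = 0%R /\ forall x, derived_series G n (a.2 x).
Proof.
pose B m := [set a : wreath V G | a.1 = 0%R /\
  forall x, derived_series G m (a.2 x)].
have gB m : is_subgroup (B m).
  have gD := derived_series_subgroup G m.
  apply/subgroupP; split; first by split=> // x; apply: subgroup1.
  move=> c d [c0 cD] [d0 dD]; split=> [|x] /=.
    by rewrite c0 d0 subr0.
  by apply: subgroupM => //; apply: subgroupV.
elim: n a => [|n IHn] a.
  apply: (derived_series_min (gB 0)) => c d _ _; split=> //; exact: wr_commg1.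
move/(derived_series_min (gB n.+1)); apply=> c d /IHn[c0 cD] /IHn[d0 dD].
have E (f : wreath V G) : f.1 = 0%R -> f = wr_base f.2.
  by case: f => f1 f2 /= ->.
rewrite (E c c0) (E d d0) wr_baseR; split=> // x /=; exact: derivedR.
Qed.

End Wreath.

Arguments wr_shift {V G} v.

(** A group separated by homomorphisms to G embeds in a power of G. *)
Lemma law_separated (G K : groupType) (I : Type) (r : I -> K -> G) w :
  (forall i, mulmorph (r i)) -> (forall x, (forall i, r i x = 1) -> x = 1) ->
  law G w -> law K w.
Proof.
move=> rM rI Gw v; apply: rI => i; rewrite -(Gw (fun n => r i (v n))).
rewrite /eval_word (mulmorph_prod (rM i)); apply: eq_bigr => p _.
by case: ifP => // _; apply: mulmorphV.
Qed.

Lemma derived_series_sub (G K : groupType) (f : G -> K) n x :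
  mulmorph f -> derived_series G n x -> derived_series K n (f x).
Proof.
move=> fM; elim: n x => // n IHn x.
have gB := preimage_subgroup fM (derived_series_subgroup K n.+1).
apply: (derived_series_min gB).
move=> y z /IHn yD /IHn zD; rewrite /preimage /= mulmorphR //.
exact: derivedR.
Qed.

Section WreathSubgroup.
Context (V : zmodType) (G : groupType) (A : set (wreath V G)).
Context (gA : is_subgroup A).
Local Notation H := (subgroup_type gA).

Lemma wreath_subgroup_product M :
  variety M -> M G -> product_variety M abelian_groups H.
Proof.
case=> W MW /MW GW.
have vM : mulmorph (val : H -> wreath V G) by exact: valM.
pose K := [set h : H | (val h).1 = 0%R].
have gK : is_subgroup K.
  apply/subgroupP; split=> // x y; rewrite /K /= => x0 y0.
  by rewrite /= x0 y0 subr0.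
have KJ (x y : H) : K x -> K (x ^ y).
  rewrite /K /= => x0; rewrite /= x0 add0r; exact: addNr.
exists (NormalSubgroup gK KJ); split.
  apply/MW => w /GW; pose r (x : V) (k : nsubg_type (NormalSubgroup gK KJ)) :=
    (val (val k)).2 x.
  apply: (@law_separated _ _ _ r) => [x k l|k k1].
    have /set_mem := valP k; rewrite /r /K /= => k0.
    by rewrite k0 addr0.
  apply/val_inj/val_inj; have /set_mem := valP k.
  rewrite /= /K /= => k0; rewrite [LHS]surjective_pairing k0.
  by congr pair; apply/funext => x; rewrite -[RHS](k1 x).
move=> u v; have [x ->] := cls_surj u; have [y ->] := cls_surj v.
rewrite [LHS]quo_mulE [RHS]quo_mulE; apply/eq_cls/mem_set => /=.
rewrite /K /=; set a := (subgroup_val x).1; set b := (subgroup_val y).1.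
by rewrite (addrC b) addNr.
Qed.

(** The upper bound holds for every subgroup of the wreath product. The lower
bound comes from evaluation at x0, which maps the m.+1-st derived group of H
onto the m-th derived group of G as soon as it maps the first one onto G; the
nontrivial h settles the case of trivial G. *)
Lemma wreath_subgroup_solvable l (x0 : V) :
  solvable_of_length l G ->
  (exists h : H, h <> 1) ->
  (forall g : G, exists2 h : H, derived [set: H] h & (val h).2 x0 = g) ->
  solvable_of_length l.+1 H.
Proof.
move=> [Gl Gm] [h h1] ev.
have vM : mulmorph (val : H -> wreath V G) by exact: valM.
split.
  apply/seteqP; split=> [k|_ ->]; last exact: derived_series1.
  move/(derived_series_sub vM)/derived_series_wreath; rewrite Gl => -[k0 kE].
  apply/val_inj; rewrite [LHS]surjective_pairing /= k0; congr pair.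
  by apply/funext => x; rewrite [LHS]kE.
have evD m g : derived_series G m g ->
    exists2 h : H, derived_series H m.+1 h & (val h).2 x0 = g.
  elim: m g => [|m IHm] g; first by move=> _; apply: ev.
  pose B := [set g | exists2 h : H, derived_series H m.+2 h & (val h).2 x0 = g].
  have D0 (k : H) n : derived_series H n.+1 k -> (val k).1 = 0%R.
    by move/(derived_series_sub vM)/derived_series_wreath => -[].
  have gD := derived_series_subgroup H m.+2.
  have gB : is_subgroup B.
    apply/subgroupP; split; first by exists 1 => //; apply: (subgroup1 gD).
    move=> _ _ [a Da <-] [b Db <-]; exists (a * b^-1).
      by apply: (subgroupM gD) => //; apply: (subgroupV gD).
    have a0 := D0 _ _ Da; have b0 := D0 _ _ Db.
    by rewrite /= in a0 b0 *; rewrite a0 b0 addr0 subr0.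
  apply: (derived_series_min gB) => _ _ /IHm[a Da <-] /IHm[b Db <-].
  exists [~ a, b]; first exact: derivedR.
  have a0 := D0 _ _ Da; have b0 := D0 _ _ Db.
  rewrite /= in a0 b0 *; rewrite a0 b0.
  by rewrite !(addr0, subr0, oppr0).
case=> [_ /seteqP[/(_ h I) //]|m]; rewrite ltnS => /[dup] lm /Gm nE Hm.
apply: nE; apply/seteqP; split=> [g /evD[k]|_ ->]; last first.
  exact: derived_series1.
by rewrite Hm => -> <-.
Qed.

End WreathSubgroup.

(** * Layers, counting multiples, and the additive abelianization *)

(** The largest exponent on either side is determined by the size of the sum, so
it occurs on both sides and cancels. *)
Lemma pow3_sum i j k l : 3 ^ i + 3 ^ l = 3 ^ k + 3 ^ j ->
  i = k /\ j = l \/ i = j /\ k = l.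
Proof.
have lt3 x y z : x < z -> y < z -> 3 ^ x + 3 ^ y < 3 ^ z.
  case: z => // z xz yz; rewrite expnS.
  have := @leq_pexp2l 3 x z isT xz; have := @leq_pexp2l 3 y z isT yz.
  have : 0 < 3 ^ z by rewrite expn_gt0.
  lia.
have inj3 := @expnI 3 isT.
have lt4 x y z t : 3 ^ x + 3 ^ y = 3 ^ z + 3 ^ t -> z <= t -> y <= t -> x <= t
   -> x = t \/ y = t.
  move=> E zt yt xt; case: (ltngtP x t) xt => // [xt|]; last by left.
  case: (ltngtP y t) yt => // [yt|]; last by right.
  by have := lt3 _ _ _ xt yt; lia.
wlog le_lj : i j k l / l <= j.
  move=> W E; case: (leqP l j) => [|/ltnW] le; first exact: W E.
  have /W[] : 3 ^ k + 3 ^ j = 3 ^ i + 3 ^ l by [].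
  - exact: le.
  - by move=> [-> ->]; left.
  - by move=> [-> ->]; right.
wlog le_kj : i j k l le_lj / k <= j.
  move=> W E; case: (leqP k j) => [|/ltnW] le; first exact: W E.
  have /W[] : 3 ^ i + 3 ^ l = 3 ^ j + 3 ^ k by rewrite E addnC.
  - exact: leq_trans le_lj le.
  - exact: le.
  - by move=> [-> ->]; right.
  - by move=> [-> ->]; left.
move=> E; have [le_ij|lt_ji] := leqP i j.
  have [ij|lj] := lt4 _ _ _ _ E le_kj le_lj le_ij.
    by right; split=> //; apply/inj3; move: E; rewrite ij; lia.
  by left; split=> //; apply/inj3; move: E; rewrite lj; lia.
have := lt3 k j i; have : 0 < 3 ^ l by rewrite expn_gt0.
by move: E lt_ji le_kj; lia.
Qed.

(** Powers of 3 have distinct differences; powers of 2 do too, but powers of 3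
are all odd, which excludes the difference -1. *)
Lemma countable_sidon (T : Type) (c : T -> nat) : injective c ->
  exists a : T -> int,
    [/\ injective a,
        forall i j k l, i <> j -> (a i - a j = a k - a l)%R -> i = k /\ j = l
      & forall i j, (a i - a j <> -1)%R].
Proof.
move=> cI; have inj3 := @expnI 3 isT; exists (fun i => Posz (3 ^ c i)%N); split.
- by move=> i j [/inj3/cI].
- move=> i j k l ij E; have : 3 ^ c i + 3 ^ c l = 3 ^ c k + 3 ^ c j by lia.
  by case/pow3_sum => -[/cI ? /cI ?].
- move=> i j E; have : odd (3 ^ c i) = ~~ odd (3 ^ c j) by lia.
  by rewrite !oddX !orbT.
Qed.

(** The decoding of layers, and of differences of layers, into fillings. *)
Lemma partial_inverse (N T : Type) (P : N -> T -> Prop) :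
  (forall n x y, P n x -> P n y -> x = y) ->
  exists d : N -> option T, forall n x, d n = Some x <-> P n x.
Proof.
move=> Pf.
have /choice[d dP] n : exists o : option T, forall x, o = Some x <-> P n x.
  have [[y Py]|nP] := pselect (exists y, P n y).
    by exists (Some y) => x; split=> [[<-]//|Px]; congr Some; apply: Pf Px.
  by exists None => x; split=> // Px; case: nP; exists x.
by exists d.
Qed.

Lemma dvdz_addl (d x y : int) : (d %| x)%Z -> (d %| (x + y)%R)%Z = (d %| y)%Z.
Proof. exact: rpredDl. Qed.

Lemma card_multiples_period (d : nat) (z : int) : (0 < d)%N ->
  \sum_(i < d) (d %| (z + i%:Z)%R)%Z = 1%N.
Proof.
move=> d0; have dz : (d%:Z != 0 :> int)%R by lia.
have r_lt : (`|(- z) %% d|%Z < d)%N.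
  have := @modz_ge0 (- z)%R d dz; have := @ltz_pmod (- z)%R d; lia.
rewrite (bigD1 (Ordinal r_lt)) //= big1 => [|i].
  rewrite -[z in (z + _)%R]opprK addrC -eqz_mod_dvd.
  by rewrite gez0_abs ?modz_ge0 // modz_mod eqxx.
rewrite -val_eqE /= => ne.
rewrite -[z]opprK addrC -eqz_mod_dvd (modz_small (m := i)).
  by case: eqP => // E; case/eqP: ne; rewrite -E.
by rewrite /= ltz_nat ltn_ord.
Qed.

Lemma card_multiples (n q d : nat) (z : int) : (0 < d)%N -> n = (q * d)%N ->
  \sum_(i < n) (d %| (z + i%:Z)%R)%Z = q.
Proof.
move=> d0 ->; elim: q => [|q IHq]; first by rewrite mul0n big_ord0.
rewrite mulSnr big_split_ord /= IHq -[RHS]addn1; congr addn.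
rewrite -(@card_multiples_period d (z + (q * d)%N%:Z)%R d0).
by apply: eq_bigr => i _; rewrite PoszD addrA.
Qed.

Lemma int_closed (Q : int -> Prop) : Q 1%R -> (forall y, Q y -> Q (- y)%R) ->
  (forall y z, Q y -> Q z -> Q (y + z)%R) -> forall z, Q z.
Proof.
move=> Q1 QN QD.
have Q0 : Q 0%R by rewrite -(subrr (1%R : int)); apply/QD/QN.
have Qn (n : nat) : Q n.
  by elim: n => // n IHn; rewrite -addn1 PoszD; apply: QD.
by case=> n; rewrite ?NegzE //; apply: QN.
Qed.

(** The abelianization written additively, so that sums over finite index sets
may be reordered. *)
Definition abz (G : groupType) : Type := abelianization G.

Section AdditiveAbelianization.
Context (G : groupType).
Local Notation cls := (\pi_(abelianization G) : G -> abelianization G)%qT.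

HB.instance Definition _ := Choice.on (abz G).

Lemma ab_mulC : commutative (fun u v : abelianization G => u * v).
Proof.
move=> u v; have [x ->] := cls_surj u; have [y ->] := cls_surj v.
rewrite [LHS]quo_mulE [RHS]quo_mulE; apply/eq_cls/mem_set => /=.
by rewrite invgM -mulgA; apply: (@derivedR G [set: G] y x I I).
Qed.

HB.instance Definition _ := GRing.isZmodule.Build (abz G)
  (@mulgA (abelianization G)) ab_mulC (@mul1g (abelianization G))
  (@mulVg (abelianization G)).

Definition ab (x : G) : abz G := cls x.

Lemma abM x y : ab (x * y) = (ab x + ab y)%R.
Proof. by rewrite /ab -quo_mulE. Qed.

Lemma ab_eq0 x : ab x = 0%R <-> derived [set: G] x.
Proof.
have E : coset_rel (derived_subgroup G) x 1 <-> derived [set: G] x.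
  have gD := derived_group G.
  rewrite /coset_rel mulg1; split=> [/set_mem|] Dx.
    by rewrite -[x]invgK; apply: (subgroupV gD).
  by apply/mem_set; apply: (subgroupV gD).
by rewrite -E -eq_cls.
Qed.

Lemma ab1 : ab 1 = 0%R.
Proof. by apply/ab_eq0; apply: (subgroup1 (derived_group G)). Qed.

Lemma abV x : ab x^-1 = (- ab x)%R.
Proof. by apply: (@addIr _ (ab x)); rewrite -abM mulVg ab1 addNr. Qed.

Lemma abX x n : ab (x ^+ n) = (ab x *+ n)%R.
Proof.
by elim: n => [|n IHn]; rewrite ?ab1 // expgS abM IHn mulrS.
Qed.

Lemma ab_prod I (r : seq I) (P : pred I) (F : I -> G) :
  ab (\prod_(i <- r | P i) F i) = (\sum_(i <- r | P i) ab (F i))%R.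
Proof. exact: (big_morph ab abM ab1). Qed.

Lemma ab_eq x y : ab x = ab y -> derived [set: G] (x^-1 * y).
Proof. by move=> E; apply/ab_eq0; rewrite abM abV E addNr. Qed.

Lemma ab_surj u : exists x, u = ab x.
Proof. exact: cls_surj. Qed.

End AdditiveAbelianization.

(** * The tape and the group it generates *)

(** A splitting of the abelianization into a free and a torsion part, expressed
through elements of G because these are what the tape is filled with; the
values of coord make the basis independent modulo G'. *)
Definition ab_split (G : groupType) : Prop :=
  exists (I : Type) (basis : I -> G) (coord : I -> G -> int) (ts : seq G),
  [/\ forall i x y, coord i (x * y) = (coord i x + coord i y)%R,
      forall i j, coord i (basis j) = (`[< i = j >])%:R%R,
      forall t, t \in ts -> exists2 e, (0 < e)%N & derived [set: G] (t ^+ e)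
    & generated (derived [set: G] `|` range basis `|` [set` ts]) = [set: G]].

(** The three kinds of fillings of the tape: constant value b_i, value g on the
lattice, and the filling that serves all torsion elements. *)
Inductive slot (I T : Type) : Type := Constant of I | Lattice of T | Torsion.
Arguments Constant {I T} i.
Arguments Lattice {I T} g.
Arguments Torsion {I T}.

Definition slot_code I T (d : I -> nat) (c : T -> nat) (j : slot I T) : nat :=
  match j with
  | Constant i => (d i).*2.+1 | Lattice g => (c g).*2.+2 | Torsion => 0
  end.

Lemma slot_code_inj I T (d : I -> nat) (c : T -> nat) :
  injective d -> injective c -> injective (slot_code d c).
Proof.
move=> dI cI [i|g|] [j|h|] //= E; try lia.
  by congr Constant; apply: dI; lia.
by congr Lattice; apply: cI; lia.
Qed.

Section Construction.
Context (G : groupType) (I : Type) (basis : I -> G) (coord : I -> G -> int).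
Context (ts : seq G) (e : nat).
Hypothesis coordM : forall i x y, coord i (x * y) = (coord i x + coord i y)%R.
Hypothesis coord_basis : forall i j, coord i (basis j) = (`[< i = j >])%:R%R.
Hypothesis e_gt0 : (0 < e)%N.
Hypothesis tsX : forall t, t \in ts -> derived [set: G] (t ^+ e).
Hypothesis genG :
  generated (derived [set: G] `|` range basis `|` [set` ts]) = [set: G].

Local Notation slot := (slot I G).
Local Notation plane := (int * int)%type.
Local Notation V := (int * (int * int))%type.
Local Notation W := (wreath V G).
Local Notation k := (size ts).
Local Notation N := (e ^ k)%N.

Lemma N_gt0 : (0 < N)%N. Proof. by rewrite expn_gt0 e_gt0. Qed.

Definition in_lattice (p : plane) : bool := (N %| p.1)%Z && (N %| p.2)%Z.

(** The function w of the introduction, with sublattices indexed from 0. *)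
Definition pattern (p : plane) : G :=
  \prod_(j < k)
    (if ((e ^ j)%N %| p.1)%Z && ((e ^ (k - j))%N %| p.2)%Z
     then nth 1 ts j else 1).

Definition filling (j : slot) (p : plane) : G :=
  match j with
  | Constant i => basis i
  | Lattice g => if in_lattice p then g else 1
  | Torsion => expz (pattern p) (p.1 %/ N)%Z
  end.

Definition slot_coord (j : slot) (g : G) : int :=
  if j is Constant i then coord i g else 0%R.

Variables (a : slot -> int) (slot_of : int -> option slot)
  (diff_of : int -> option (slot * slot)).
Hypothesis a_sidon : forall i j l m,
  i <> j -> (a i - a j = a l - a m)%R -> i = l /\ j = m.
Hypothesis a_diff1 : forall i j, (a i - a j <> -1)%R.
Hypothesis slot_ofP : forall n j, slot_of n = Some j <-> a j = n.
Hypothesis diff_ofP : forall n ij,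
  diff_of n = Some ij <-> ij.1 <> ij.2 /\ (a ij.2 - a ij.1 = n)%R.

Definition tape (x : V) : G :=
  if slot_of x.1 is Some j then filling j x.2 else 1.

Definition layer (u : plane -> G) : W :=
  wr_base (fun x : V => if x.1 == 0%R then u x.2 else 1).

(** The layers other than 0 are forced by the wish that the copy of b_i be a
translate of the tape. *)
Definition copy_fun (g : G) (x : V) : G :=
  if x.1 == 0%R then g
  else if diff_of x.1 is Some ij
  then expz (filling ij.2 x.2) (slot_coord ij.1 g) else 1.

Definition copy (g : G) : W := wr_base (copy_fun g).

Definition gens : seq W :=
  [:: wr_shift (1, (0, 0))%R; wr_shift (0, (1, 0))%R;
      wr_shift (0, (0, 1))%R; wr_base tape].

Definition gen (i : 'I_4) : W := nth 1 gens i.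

Local Notation A := (generated (range gen)).

Local Notation gA := (generated_subgroup (range gen)).

Lemma gens_in i : (i < 4)%N -> A (nth 1 gens i).
Proof. by move=> i4; apply: sub_generated; exists (Ordinal i4). Qed.

Lemma tape_in : A (wr_base tape). Proof. exact: (@gens_in 3). Qed.

Lemma shift_in v : A (wr_shift v).
Proof.
have shM (w : int -> V) :
    (forall y z, w (y + z) = w y + w z)%R -> A (wr_shift (w 1%R)) ->
    forall y, A (wr_shift (w y)).
  move=> wD w1; apply: int_closed => // [y|y z] wy; last first.
    by move=> wz; rewrite wD -wr_shiftM; apply: (subgroupM gA).
  have -> : w (- y)%R = (- w y)%R.
    have w0 : w 0%R = 0%R.
      by apply: (@addIr _ (w 0%R)); rewrite -wD addr0 add0r.
    by apply: (@addIr _ (w y)); rewrite -wD !addNr.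
  by rewrite -wr_shiftV; apply: (subgroupV gA).
case: v => n [l m].
have -> : (n, (l, m)) = ((n, (0, 0)) + ((0, (l, 0)) + (0, (0, m))))%R :> V.
  by congr (_, (_, _)); rewrite /= ?addr0 ?add0r.
rewrite -!wr_shiftM; apply: (subgroupM gA); last apply: (subgroupM gA).
- by apply: (shM (fun z => (z, (0, 0)))%R) => //; apply: (@gens_in 0).
- by apply: (shM (fun z => (0, (z, 0)))%R) => //; apply: (@gens_in 1).
- by apply: (shM (fun z => (0, (0, z)))%R) => //; apply: (@gens_in 2).
Qed.

Lemma translate_in (u : V -> G) v :
  A (wr_base u) -> A (wr_base (fun x => u (x + v)%R)).
Proof.
by move=> Au; rewrite -wr_baseJ; apply: (subgroupJ gA) => //; apply: shift_in.
Qed.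

Lemma layerM u u' : layer u * layer u' = layer (fun p => u p * u' p).
Proof.
rewrite /layer wr_baseM; congr wr_base; apply/funext => x /=.
by case: ifP => // _; rewrite mulg1.
Qed.

Lemma layer1 : layer (fun=> 1) = 1.
Proof. by congr pair; apply/funext => x /=; rewrite if_same. Qed.

Lemma layer_translate_in u q :
  A (layer u) -> A (layer (fun p => u (p + q)%R)).
Proof.
move=> /(translate_in (0%R, q)); congr A; congr wr_base; apply/funext => x /=.
by rewrite addr0.
Qed.

Lemma layer_prod_in T (r : seq T) (F : T -> plane -> G) :
  (forall i, A (layer (F i))) -> A (layer (fun p => \prod_(i <- r) F i p)).
Proof.
move=> AF; elim: r => [|i r IHr].
  have -> : (fun p => \prod_(i <- [::]) F i p) = fun=> 1.
    by apply/funext => p; rewrite big_nil.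
  by rewrite layer1; apply: (subgroup1 gA).
have -> : (fun p => \prod_(j <- i :: r) F j p) =
    fun p => F i p * \prod_(j <- r) F j p.
  by apply/funext => p; rewrite big_cons.
by rewrite -layerM; apply: (subgroupM gA).
Qed.

Lemma slot_of_a j : slot_of (a j) = Some j. Proof. exact/slot_ofP. Qed.

Lemma slot_of_shift j n i : slot_of (n + a j)%R = Some i -> (a i - a j = n)%R.
Proof. by move/slot_ofP=> ->; rewrite addrK. Qed.

(** Two translates of the tape that show different fillings on layer 0 commute
on every other layer, since a common layer would be a repeated difference. *)
Lemma commutator_in x y :
  A (layer (fun p => if in_lattice p then [~ x, y] else 1)).
Proof.
have [->|xy] := pselect (x = y).
  have -> : (fun p => if in_lattice p then [~ y, y] else 1) = fun=> 1.
    by apply/funext => p; rewrite commgg if_same.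
  by rewrite layer1; apply: (subgroup1 gA).
have Tx z := translate_in (a (Lattice z), 0%R) tape_in.
have := subgroupR gA (Tx x) (Tx y); congr A.
rewrite wr_baseR; congr wr_base; apply/funext => -[n p].
rewrite /tape /= addr0; case: (n =P 0%R) => [->|n0].
  by rewrite !add0r !slot_of_a /=; case: ifP => // _; rewrite commgg.
case Ei: (slot_of _) => [i|]; last by rewrite comm1g.
case Ej: (slot_of _) => [j|]; last by rewrite commg1.
have := slot_of_shift Ei; have := slot_of_shift Ej => En En'.
have [ij|ij] := pselect (i = Lattice x).
  by case: n0; rewrite -En' ij subrr.
by have [_ [/xy]] := a_sidon ij (etrans En' (esym En)).
Qed.

Lemma derived_lattice_in g : derived [set: G] g ->
  A (layer (fun p => if in_lattice p then g else 1)).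
Proof.
pose L g := layer (fun p => if in_lattice p then g else 1).
have LM : mulmorph L.
  move=> x y; rewrite /L layerM; congr layer; apply/funext => p.
  by case: ifP => // _; rewrite mulg1.
apply: (derived_min (preimage_subgroup LM gA)) => x y _ _.
exact: commutator_in.
Qed.

Definition periodic (u : plane -> G) : Prop :=
  forall p q, in_lattice (p - q)%R -> u p = u q.

Lemma in_latticeB p q r :
  in_lattice (p - q)%R -> in_lattice (p - r)%R = in_lattice (q - r)%R.
Proof.
rewrite /in_lattice /= => /andP[d1 d2].
have E (x y z : int) : (x - z = (x - y) + (y - z))%R by lia.
by rewrite (E p.1 q.1) (E p.2 q.2) (dvdz_addl _ d1) (dvdz_addl _ d2).
Qed.

(** A periodic function is the product of its restrictions to the finitely many
cosets of the lattice, peeled off here one coset at a time. *)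
Lemma periodic_in u : periodic u -> (forall p, derived [set: G] (u p)) ->
  A (layer u).
Proof.
pose covered (s : seq plane) (u : plane -> G) :=
  forall p, u p = 1 \/ exists2 b, b \in s & in_lattice (p - b)%R.
suff W s : forall u, periodic u -> (forall p, derived [set: G] (u p)) ->
    covered s u -> A (layer u).
  (* The box [0, N) x [0, N) meets every coset of the lattice. *)
  move=> pu Du; pose r := iota 0 N.
  apply: (W [seq (Posz i, Posz j) | i <- r, j <- r]) => //.
  move=> p; right; exists (p.1 %% N, p.2 %% N)%Z.
    have N0 := N_gt0; have Nz : (N%:Z != 0 :> int)%R by lia.
    have r_iota z : `|z %% N|%Z%N \in iota 0 N.
      rewrite mem_iota; have := @modz_ge0 z N Nz.
      by have := @ltz_pmod z N; lia.
    apply/allpairsP; exists (`|p.1 %% N|%Z%N, `|p.2 %% N|%Z%N); split=> //=.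
    by rewrite !gez0_abs // modz_ge0.
  by rewrite /in_lattice /= -!eqz_mod_dvd !modz_mod !eqxx.
elim: s => [|b s IHs] {}u pu Du cu.
  have -> : u = fun=> 1 by apply/funext => p; case: (cu p) => // -[].
  by rewrite layer1; apply: (subgroup1 gA).
pose u1 p := if in_lattice (p - b)%R then u b else 1.
pose u2 p := if in_lattice (p - b)%R then 1 else u p.
have -> : u = fun p => u1 p * u2 p.
  apply/funext => p; rewrite /u1 /u2.
  by case: ifP => [/pu ->|_]; rewrite ?mulg1 ?mul1g.
rewrite -layerM; apply: (subgroupM gA).
  exact: (layer_translate_in (- b)%R (derived_lattice_in (Du b))).
apply: IHs.
- by move=> p q pq; rewrite /u2 (in_latticeB _ pq) (pu _ _ pq).
- move=> p; rewrite /u2; case: ifP => // _.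
  exact: (subgroup1 (derived_group G)).
- move=> p; rewrite /u2; case: ifPn => [_|pb]; first by left.
  have [->|[b' b's pb']] := cu p; first by left.
  right; exists b' => //; move: b's; rewrite inE => /predU1P[E|//].
  by rewrite E (negbTE pb) in pb'.
Qed.

Lemma pattern_periodic : periodic pattern.
Proof.
move=> p q /andP[d1 d2]; apply: eq_bigr => j _.
have E (d : nat) (x y : int) :
    (d %| N)%N -> (N %| (x - y)%R)%Z -> (d %| x)%Z = (d %| y)%Z.
  move=> dN Nxy; have dxy : (d %| (x - y)%R)%Z by apply: dvdz_trans Nxy.
  by rewrite -[x in LHS](subrK y) dvdz_addl.
by rewrite (E _ p.1 q.1) ?(E _ p.2 q.2) //; apply: dvdn_exp2l;
  rewrite ?leq_subr // ltnW.
Qed.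

(** Dividing two translates of the tape, N apart along the first axis of the
plane, cancels every filling that is invariant under this translation. *)
Lemma pattern_in : A (layer pattern).
Proof.
have T1 := translate_in (a Torsion, (N%:Z, 0))%R tape_in.
have T2 := translate_in (a Torsion, 0%R) tape_in.
have := subgroupM gA T1 (subgroupV gA T2); congr A.
rewrite wr_baseV wr_baseM; congr wr_base; apply/funext => -[n p].
rewrite /tape /= addr0.
have [->|n0] := eqVneq n 0%R.
  rewrite add0r slot_of_a /= divzDr ?dvdzz // divzz.
  have -> : (N%:Z != 0 :> int)%R by have := N_gt0; lia.
  rewrite (pattern_periodic (q := p)); last first.
    by rewrite /in_lattice /= addrAC subrr add0r addr0
      subrr dvdz0 dvdzz.
  by rewrite addrC expzD mulgK.
case Ei: (slot_of _) => [[g|g|]|] /=; rewrite ?mulgV //.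
  rewrite /in_lattice /= addr0 (addrC _ (Posz N)) dvdz_addl ?dvdzz // mulgV //.
by move/slot_of_shift: Ei n0 => <-; rewrite subrr eqxx.
Qed.

Definition box (i : nat) (p : plane) : G :=
  \prod_(l < e ^ i) \prod_(m < e ^ (k - i)) pattern (p + (l%:Z, m%:Z))%R.

Lemma box_in i : A (layer (box i)).
Proof.
do 2!apply: layer_prod_in => ?; apply: layer_translate_in; exact: pattern_in.
Qed.

Lemma box_periodic i : periodic (box i).
Proof.
move=> p q pq; do 2!apply: eq_bigr => ? _; apply: pattern_periodic.
by rewrite opprD addrACA subrr addr0.
Qed.

(** Modulo G' only the number of points of each sublattice in the box matters.
If j < i the first side of the box meets e ^ (i - j) multiples of e ^ j, and if
j > i the second side meets e ^ (j - i) multiples of e ^ (k - j); either way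
the count is divisible by e. *)
Lemma ab_box i p : (i < k)%N -> ab (box i p) = ab (nth 1 ts i).
Proof.
move=> ik; rewrite /box ab_prod.
pose t j : abz G := ab (nth 1 ts j).
pose n1 j := \sum_(l < e ^ i) ((e ^ j)%N %| (p.1 + l%:Z)%R)%Z.
pose n2 j := \sum_(m < e ^ (k - i)) ((e ^ (k - j))%N %| (p.2 + m%:Z)%R)%Z.
transitivity (\sum_(j < k) t j *+ (n1 j * n2 j)%N)%R.
  rewrite (eq_bigr (fun l : 'I_(e ^ i) => \sum_(j < k) t j *+
     (((e ^ j)%N %| (p.1 + (l : nat)%:Z)%R)%Z * n2 j)%N)%R) => [|l _].
    rewrite exchange_big; apply: eq_bigr => j _ /=.
    by rewrite sumrMnr /n1 big_distrl.
  rewrite ab_prod (eq_bigr (fun m : 'I_(e ^ (k - i)) =>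
    \sum_(j < k) t j *+ (((e ^ j)%N %| (p.1 + (l : nat)%:Z)%R)%Z *
       ((e ^ (k - j))%N %| (p.2 + (m : nat)%:Z)%R)%Z)%N)%R) => [|m _].
    rewrite exchange_big; apply: eq_bigr => j _ /=.
    by rewrite sumrMnr /n2 big_distrr.
  rewrite ab_prod; apply: eq_bigr => j _ /=.
  by case: (_ %| _)%Z; case: (_ %| _)%Z; rewrite /= ?ab1.
have n1E j : (j <= i)%N -> n1 j = (e ^ (i - j))%N.
  move=> ji; apply: card_multiples; first by rewrite expn_gt0 e_gt0.
  by rewrite -expnD subnK.
have n2E j : (i <= j)%N -> (j <= k)%N -> n2 j = (e ^ (j - i))%N.
  move=> ij jk; apply: card_multiples; first by rewrite expn_gt0 e_gt0.
  by rewrite -expnD addnC addnBA // subnK.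
rewrite (bigD1 (Ordinal ik)) //= big1 => [|j].
  by rewrite n1E // n2E ?(ltnW ik) // subnn expn0 addr0.
rewrite -val_eqE /= => ji.
have eX : (t j *+ e = 0)%R.
  by rewrite -abX; apply/ab_eq0; apply: tsX; rewrite mem_nth.
suff /dvdnP[q ->] : (e %| n1 j * n2 j)%N by rewrite mulnC mulrnA eX mul0rn.
have [lt|le] := ltnP j i.
  by rewrite n1E 1?ltnW // dvdn_mulr // dvdn_exp // subn_gt0.
have lt : (i < j)%N by rewrite ltn_neqAle eq_sym ji.
by rewrite n2E // 1?ltnW // dvdn_mull // dvdn_exp // subn_gt0.
Qed.

(** The constant t differs from a box product by a periodic function to G'. *)
Lemma torsion_in t : t \in ts -> A (layer (fun=> t)).
Proof.
move=> tts; pose i := index t ts.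
have ik : (i < k)%N by rewrite index_mem.
have -> : (fun=> t) = fun p => box i p * ((box i p)^-1 * t).
  by apply/funext => p; rewrite mulVKg.
rewrite -layerM; apply: (subgroupM gA); first exact: box_in.
apply: periodic_in => [p q pq|p]; first by rewrite (box_periodic i pq).
by apply: ab_eq; rewrite ab_box // nth_index.
Qed.

Lemma copy_morph : mulmorph copy.
Proof.
move=> g h; rewrite /copy wr_baseM; congr wr_base; apply/funext => -[n p].
rewrite /copy_fun /=; case: ifP => // _.
case: (diff_of n) => [[i j]|] /=; last by rewrite mulg1.
rewrite -expzD; congr expz; case: i => [s|s|] /=; rewrite ?addr0 //.
Qed.

Lemma copy_inj : injective copy.
Proof. by move=> g h [] /(congr1 (fun u => u 0%R)). Qed.

Lemma copy_torsion g : (forall s, coord s g = 0%R) -> copy g = layer (fun=> g).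
Proof.
move=> g0; congr wr_base; apply/funext => -[n p]; rewrite /copy_fun /=.
case: ifP => // _; case: (diff_of n) => [[[s|s|] j]|] //=.
by rewrite g0.
Qed.

Lemma coord1 s : coord s 1 = 0%R.
Proof.
by apply: (@addIr _ (coord s 1)); rewrite -coordM mulg1 add0r.
Qed.

Lemma coordV s x : coord s x^-1 = (- coord s x)%R.
Proof.
by apply: (@addIr _ (coord s x)); rewrite -coordM mulVg coord1 addNr.
Qed.

Lemma coordX s x n : coord s (x ^+ n) = (coord s x *+ n)%R.
Proof.
by elim: n => [|n IHn]; rewrite ?coord1 // expgS coordM IHn mulrS.
Qed.

Lemma coord_derived s g : derived [set: G] g -> coord s g = 0%R.
Proof.
have gK : is_subgroup [set g | coord s g = 0%R].
  apply/subgroupP; split; first exact: coord1.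
  by move=> x y /= x0 y0; rewrite coordM coordV x0 y0 subr0.
apply: (derived_min gK) => x y _ _ /=.
by rewrite /commg /conjg !coordM !coordV; lia.
Qed.

Lemma coord_torsion s t : t \in ts -> coord s t = 0%R.
Proof.
move/tsX/(coord_derived s)/eqP; rewrite coordX.
rewrite mulrn_eq0 => /orP[|/eqP //].
by rewrite eqn0Ngt e_gt0.
Qed.

(** On layer 0 both sides show b_s; on another layer the translated tape shows a
filling exactly when the layer is a difference starting at a_s, and the
coordinates of b_s select these differences. *)
Lemma copy_basis s :
  copy (basis s) = wr_base (fun x => tape (x + (a (Constant s), 0))%R).
Proof.
congr wr_base; apply/funext => -[n p].
rewrite /copy_fun /tape /= addr0.
have [->|n0] := eqVneq n 0%R; first by rewrite add0r slot_of_a.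
case Ej: (slot_of _) => [j|]; last first.
  case Ed: (diff_of n) => [[i j]|] //=.
  case: i Ed => [t|t|] Ed //=; rewrite coord_basis.
  case: asboolP => // ts'; move: Ej Ed; rewrite ts' => Ej /diff_ofP[_ /= En].
  by move: Ej; rewrite -En subrK slot_of_a.
have En := slot_of_shift Ej.
have ne : Constant s <> j by move=> E; move: n0; rewrite -En E subrr eqxx.
have -> : diff_of n = Some (Constant s, j) by apply/diff_ofP.
by rewrite /= coord_basis asboolT.
Qed.

Lemma copy_in g : A (copy g).
Proof.
have : generated (derived [set: G] `|` range basis `|` [set` ts]) g.
  by rewrite genG.
have gP := preimage_subgroup copy_morph gA.
apply: (generated_min gP) => {}g [[Dg|[i _ <-]]|/= tg].
- rewrite /preimage /= copy_torsion => [|s]; last exact: coord_derived.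
  exact: periodic_in.
- rewrite /preimage /= copy_basis; apply: translate_in; exact: tape_in.
- rewrite /preimage /= copy_torsion => [|s]; last exact: coord_torsion.
  exact: torsion_in.
Qed.

Local Notation H := (subgroup_type gA).

Definition embedding (g : G) : H := SubgroupElt gA (mem_set (copy_in g)).

Lemma embedding_morph : mulmorph embedding.
Proof. by move=> g h; apply/val_inj/copy_morph. Qed.

Lemma embeds_subgroup : embeds G H.
Proof.
pose m := isMultiplicative.Build G H embedding embedding_morph.
pose f : {multiplicative G -> H} := HB.pack embedding m.
by exists f => x y /(congr1 val) /copy_inj.
Qed.

Definition layer_step : H := SubgroupElt gA (mem_set (shift_in (1, 0)%R)).

Lemma layer_step_neq1 : layer_step <> 1.
Proof. by move/(congr1 val) => -[]. Qed.

(** At the origin the commutator with the unit step is the quotient of the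
values of a copy on layers 0 and -1, and -1 is not a difference of layers of
the tape. *)
Lemma derived_onto g :
  exists2 h : H, derived [set: H] h & (val h).2 0%R = g.
Proof.
exists [~ embedding g^-1, layer_step]; first exact: derivedR.
rewrite /= invg1 mulg1 mul1g subrr add0r.
rewrite /copy_fun /= invgK.
case Ed: (diff_of _) => [[i j]|]; last by rewrite mulg1.
by have [_ /a_diff1] := (diff_ofP _ _).1 Ed.
Qed.

End Construction.

Lemma common_exponent (G : groupType) (ts : seq G) :
  (forall t, t \in ts -> exists2 e, (0 < e)%N & derived [set: G] (t ^+ e)) ->
  exists2 e, (0 < e)%N & forall t, t \in ts -> derived [set: G] (t ^+ e).
Proof.
elim: ts => [|t ts IHts] tsX; first by exists 1%N.
have [|e e0 eX] := IHts.
  by move=> u uts; apply: tsX; rewrite inE uts orbT.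
have [|d d0 dX] := tsX t; first by rewrite inE eqxx.
exists (d * e)%N => [|u]; first by rewrite muln_gt0 d0.
have DX (x : G) n : derived [set: G] x -> derived [set: G] (x ^+ n).
  move=> Dx; elim: n => [|n IHn]; first exact: (subgroup1 (derived_group G)).
  by rewrite expgS; apply: (subgroupM (derived_group G)).
rewrite inE => /predU1P[->|/eX uX]; first by rewrite expgnA; apply: DX.
by rewrite mulnC expgnA; apply: DX.
Qed.

Theorem ab_split_embedding (G : groupType) :
  countable [set: G] -> ab_split G ->
  exists H : groupType,
    [/\ k_generated 4 H, embeds G H,
        forall M, variety M -> M G -> product_variety M abelian_groups H
      & forall l, solvable_of_length l G -> solvable_of_length l.+1 H].
Proof.
move=> /countable_injP[c cI] [I [basis [coord [ts [cM cB tsX genG]]]]].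
have {}cI : injective c by move=> x y; apply: cI; rewrite inE.
have bI : injective basis.
  move=> i j E; have := cB i j; rewrite -E cB asboolT //.
  by case: asboolP.
have [e e0 {}tsX] := common_exponent tsX.
have [a [aI aS a1]] := countable_sidon (slot_code_inj (inj_comp cI bI) cI).
have [so soP] : exists so : int -> option (slot I G), forall n j,
    so n = Some j <-> a j = n.
  by apply: partial_inverse => n x y <- /aI ->.
have [df dfP] : exists df : int -> option (slot I G * slot I G), forall n ij,
    df n = Some ij <-> ij.1 <> ij.2 /\ (a ij.2 - a ij.1 = n)%R.
  apply: partial_inverse => n [i j] [k l] /= [ij <-] [_ E].
  by have [-> ->] := aS j i l k (nesym ij) (esym E).
pose s := gen basis ts e so.
exists (subgroup_type (generated_subgroup (range s))); split.
- exact: k_generated_subgroup.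
- exact (embeds_subgroup cM cB e0 tsX genG aS soP dfP).
- by move=> M; apply: wreath_subgroup_product.
- move=> l Gl; apply: (wreath_subgroup_solvable (x0 := 0%R) Gl).
    by exists (layer_step basis ts e so); apply: layer_step_neq1.
  exact (derived_onto cM cB e0 tsX genG aS a1 soP dfP).
Qed.

(** * Groups whose abelianization splits *)

Lemma ab_expz (G : groupType) (x : G) z : ab (expz x z) = (ab x *~ z)%R.
Proof. by case: z => n; rewrite /= ?abV abX. Qed.

Lemma ab_morph (G : groupType) x y :
  ab (x * y) = (ab x : abelianization G) * ab y :> abelianization G.
Proof. by rewrite [RHS]quo_mulE. Qed.

Lemma finite_torsion (K : groupType) (k : K) : finite_set [set: K] ->
  exists2 e, (0 < e)%N & k ^+ e = 1.
Proof.
move=> /finite_seqP[s sK].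
have : ~~ uniq (mkseq (fun i => k ^+ i) (size s).+1).
  apply/negP => u; have := @uniq_leq_size _ _ s u.
  rewrite size_mkseq ltnn; move/(_ _)/negP; case=> // x _.
  by have : [set` s] x by rewrite -sK.
case/(uniqPn 1) => i [j [ij]]; rewrite size_mkseq => js.
rewrite !nth_mkseq ?(ltn_trans ij) // => E.
exists (j - i)%N; first by rewrite subn_gt0.
by rewrite expgnFr ?(ltnW ij) // -E mulgV.
Qed.

(** The torsion elements are lifts, with trivial free component, of all elements
of the finite factor. *)
Lemma free_times_finite_ab_split (G : groupType) :
  free_abelian_times_finite (abelianization G) -> ab_split G.
Proof.
case=> F [K [[B [f fB]] Kfin [h hB]]].
pose p (g : G) : {freeg B / int} := f (h (ab g : abelianization G)).1.
pose q (g : G) : K := (h (ab g : abelianization G)).2.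
have pM x y : p (x * y) = (p x + p y)%R.
  by rewrite /p ab_morph !gmulfM.
have qM : mulmorph q by move=> x y; rewrite /q ab_morph !gmulfM.
have surj D k : exists g, p g = D /\ q g = k.
  have [f' f'K fK] := fB; have [h' h'K hK] := hB.
  have [g gE] := ab_surj (h' (f' D, k) : abz G).
  by exists g; rewrite /p /q -gE hK /= fK.
have inj x y : p x = p y -> q x = q y -> ab x = ab y.
  move=> /(bij_inj fB) E1 E2; apply: (bij_inj hB).
  by rewrite [LHS]surjective_pairing [RHS]surjective_pairing E1 -/(q x) E2.
have p1 : p 1 = 0%R by apply: (@addIr _ (p 1)); rewrite -pM mulg1 add0r.
have pV x : p x^-1 = (- p x)%R.
  by apply: (@addIr _ (p x)); rewrite -pM mulVg p1 addNr.
have /choice[basis basisP] b := surj << b >> 1.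
have /choice[lift liftP] k := surj 0%R k.
have [ks ksE] := (finite_seqP _).1 Kfin.
exists B, basis, (fun b g => coeff b (p g)), (map lift ks); split.
- by move=> b x y; rewrite pM coeffD.
- move=> b b'; have [-> _] := basisP b'.
  have E : (b' == b) = `[< b = b' >].
    by apply/eqP/asboolP => [->|->].
  by rewrite coeffU mul1r E.
- move=> _ /mapP[k _ ->]; have [e e0 ke] := finite_torsion k Kfin.
  have [pk qk] := liftP k.
  have pX n : p (lift k ^+ n) = 0%R.
    by elim: n => [|n IHn]; rewrite ?p1 // expgS pM IHn pk addr0.
  exists e => //; apply/ab_eq0; rewrite -(ab1 G); apply: inj.
    by rewrite pX p1.
  by rewrite (mulmorphX qM) qk ke (mulmorph1 qM).
set U := generated _; have gU : is_subgroup U by apply: generated_subgroup.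
have DU g : derived [set: G] g -> U g.
  by move=> Dg; apply: sub_generated; left; left.
(* Elements without free component agree modulo G' with one of the lifts. *)
have U0 g : p g = 0%R -> U g.
  move=> pg; have [pt qt] := liftP (q g).
  rewrite -(mulVKg (lift (q g)) g); apply: (subgroupM gU).
    apply: sub_generated; right; rewrite /= map_f //.
    by have : [set` ks] (q g) by rewrite -ksE.
  by apply: DU; apply: ab_eq; apply: inj; rewrite ?pt ?pg ?qt.
have UD D : exists2 u, U u & p u = D.
  rewrite -[D]freeg_sumE; elim/big_ind: _ => [||b _].
  - by exists 1 => //; apply: (subgroup1 gU).
  - move=> _ _ [u Uu <-] [v Uv <-]; exists (u * v); rewrite ?pM //.
    exact: (subgroupM gU).
  move: (coeff b D); apply: int_closed.
  - exists (basis b); last by case: (basisP b).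
    by apply: sub_generated; left; right; exists b.
  - move=> y [u Uu pu]; exists u^-1; first exact: (subgroupV gU).
    by rewrite pV pu freegUN.
  - move=> y z [u Uu pu] [v Uv pv]; exists (u * v); first exact: (subgroupM gU).
    by rewrite pM pu pv freegUD.
apply/seteqP; split=> // g _; have [u Uu pu] := UD (p g).
rewrite -(mulVKg u g); apply: (subgroupM gU) => //.
by apply: U0; rewrite pM pV pu addNr.
Qed.

Section FinitelyGenerated.
Context (G : groupType).
Local Open Scope ring_scope.

Definition comb n (x : 'I_n -> G) (c : 'I_n -> int) : abz G :=
  \sum_i ab (x i) *~ c i.

Lemma combD n (x : 'I_n -> G) c d :
  comb x c + comb x d = comb x (fun i => c i + d i).
Proof. by rewrite -big_split; apply: eq_bigr => i _; rewrite mulrzDr. Qed.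

Lemma combB n (x : 'I_n -> G) c d :
  comb x c - comb x d = comb x (fun i => c i - d i).
Proof. by rewrite -sumrB; apply: eq_bigr => i _; rewrite mulrzBr. Qed.

Lemma combZ n (x : 'I_n -> G) c m : comb x c *~ m = comb x (fun i => c i * m).
Proof. by rewrite mulrz_suml; apply: eq_bigr => i _; rewrite mulrzA. Qed.

Lemma comb_in (U : set G) n (x : 'I_n -> G) c g :
  is_subgroup U -> derived [set: G] `<=` U -> (forall i, U (x i)) ->
  ab g = comb x c -> U g.
Proof.
move=> gU DU xU gE; pose u := (\prod_i expz (x i) (c i))%g.
have Uu : U u.
  apply: subgroup_prod => // i _.
  have UX k : U (x i ^+ k)%g.
    elim: k => [|k IHk]; first exact: (subgroup1 gU).
    by rewrite expgS; apply: (subgroupM gU).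
  by case: (c i) => k; [apply: UX | apply: (subgroupV gU); apply: UX].
have uE : ab u = comb x c.
  by rewrite ab_prod; apply: eq_bigr => i _; rewrite ab_expz.
rewrite -(mulVKg u g); apply: (subgroupM gU) => //; apply: DU.
by apply: ab_eq; rewrite uE.
Qed.

(** The row v of coefficients has Smith normal form (m, 0, ..., 0) R with R
unimodular, so in the generators y = R x the relation reads m y_0 = 0. *)
Lemma relation_torsion n (x : 'I_n.+1 -> G) (v : 'I_n.+1 -> int) :
  (exists i, v i <> 0) -> comb x v = 0 ->
  exists (y : 'I_n.+1 -> G) (m : int), [/\ m <> 0, ab (y ord0) *~ m = 0 &
    forall j, exists c, ab (x j) = comb y c].
Proof.
move=> [k vk] v0; pose M := \row_j v j.
(* The single row v is m times the first row of R. *)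
have [L _ [R Ru [d _ ME]]] := int_Smith_normal_form M.
pose m := L 0 0 * d`_0.
have vE j : v j = m * R 0 j.
  have -> : v j = M 0 j by rewrite mxE.
  rewrite {1}ME -mulmxA mxE big_ord1 mxE (bigD1 ord0) //= big1 => [|i i0].
    by rewrite !mxE mulr1n addr0 mulrA.
  rewrite !mxE; case: eqP => [E|_]; first by case/eqP: i0; apply/val_inj.
  by rewrite mulr0n mul0r.
have /choice[y yE] i : exists y, ab y = comb x (R i).
  by have [y ->] := ab_surj (comb x (R i)); exists y.
exists y, m; split.
- by move=> m0; apply: vk; rewrite vE m0 mul0r.
- rewrite yE combZ -[RHS]v0; apply: eq_bigr => j _.
  by rewrite vE mulrC.
move=> j; exists (invmx R j); rewrite /comb.
under eq_bigr => i _ do rewrite yE combZ.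
have E l : \sum_i R i l * invmx R j i = (j == l)%:R.
  have <- : (invmx R *m R) j l = (j == l)%:R by rewrite mulVmx // mxE.
  by rewrite mxE; apply: eq_bigr => i _; rewrite mulrC.
rewrite exchange_big /=; under eq_bigr => l _ do rewrite -mulrz_sumr E.
rewrite (bigD1 j) //= eqxx mulr1z big1 ?addr0 // => l lj.
by rewrite eq_sym (negbTE lj) mulr0z.
Qed.

(** Without relations, coordinates modulo torsion are unique: a difference of
two coordinate vectors of g becomes a relation once multiplied by the orders of
the two torsion parts. *)
Lemma independent_ab_split n (x : 'I_n -> G) (ts : seq G) :
  (forall t, t \in ts -> exists2 e, (0 < e)%N & derived [set: G] (t ^+ e)%g) ->
  generated (derived [set: G] `|` range x `|` [set` ts]) = [set: G] ->
  (forall v, comb x v = 0 -> forall i, v i = 0) -> ab_split G.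
Proof.
move=> tsX genG ind.
pose rep (g : G) c := exists2 e, (0 < e)%N & (ab g - comb x c) *+ e = 0.
have rep_uniq g c d : rep g c -> rep g d -> c = d.
  move=> [e e0 ce] [f f0 df]; apply/funext => i.
  have /ind/(_ i)/eqP : comb x (fun i => (c i - d i) * (e * f)%N%:Z) = 0.
    rewrite -combZ -combB -[_ *~ _]/(_ *+ (e * f)).
    have -> : comb x c - comb x d = (ab g - comb x d) - (ab g - comb x c).
      by rewrite opprB [RHS]addrC addrA subrK.
    by rewrite mulrnBl {1}mulnC !mulrnA df ce !mul0rn subr0.
  rewrite mulf_eq0 => /orP[/eqP/subr0_eq //|].
  by rewrite eqz_nat muln_eq0 !eqn0Ngt e0 f0.
have rep_ex g : exists c, rep g c.
  have gR : is_subgroup [set g | exists c, rep g c].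
    apply/subgroupP; split.
      exists (fun=> 0); exists 1%N => //.
      by rewrite ab1 sub0r /comb big1 ?oppr0 // => i _; rewrite mulr0z.
    move=> a b [c [e e0 ce]] [d [f f0 df]].
    exists (fun i => c i - d i); exists (e * f)%N; first by rewrite muln_gt0 e0.
    have -> : ab (a * b^-1)%g - comb x (fun i => c i - d i) =
        (ab a - comb x c) - (ab b - comb x d).
      rewrite abM abV -combB !opprB [LHS]addrACA [RHS]addrACA.
      by rewrite (addrC (- ab b)).
    by rewrite mulrnBl [in X in _ - X]mulnC !mulrnA df ce !mul0rn subr0.
  have : generated (derived [set: G] `|` range x `|` [set` ts]) g.
    by rewrite genG.
  apply: (generated_min gR) => {}g [[Dg|[i _ <-]]|/= /tsX[e e0 eX]].
  - exists (fun=> 0); exists 1%N => //.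
    have -> : ab g = 0 by apply/ab_eq0.
    by rewrite sub0r /comb big1 ?oppr0 // => i _; rewrite mulr0z.
  - exists (fun j => (j == i)%:R); exists 1%N => //.
    rewrite /comb (bigD1 i) //= eqxx mulr1z big1 ?addr0 ?subrr // => j ji.
    by rewrite (negbTE ji) mulr0z.
  - exists (fun=> 0); exists e => //.
    rewrite /comb big1 ?subr0 => [|i _]; last by rewrite mulr0z.
    by rewrite -abX; apply/ab_eq0.
have /choice[coord coordP] := rep_ex.
have repD a b c d : rep a c -> rep b d -> rep (a * b)%g (fun i => c i + d i).
  move=> [e e0 ce] [f f0 df]; exists (e * f)%N; first by rewrite muln_gt0 e0.
  by rewrite abM -combD opprD addrACA mulrnDl {1}mulrnA ce mulnC mulrnA df
    !mul0rn addr0.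
exists 'I_n, x, (fun i g => coord g i), ts; split=> //.
- move=> i a b.
  by rewrite (rep_uniq _ _ _ (coordP _) (repD _ _ _ _ (coordP a) (coordP b))).
- move=> i j; have rj : rep (x j) (fun i => (`[< i = j >])%:R).
    exists 1%N => //; rewrite /comb (bigD1 j) //= asboolT // mulr1z big1.
      by rewrite addr0 subrr.
    by move=> k kj; rewrite asboolF ?mulr0z //; apply/eqP.
  by rewrite (rep_uniq _ _ _ (coordP _) rj).
Qed.

(** Induction on the number of generators outside ts: each relation among them
moves one generator, after a change of generators, into ts. *)
Lemma generators_ab_split n (x : 'I_n -> G) (ts : seq G) :
  (forall t, t \in ts -> exists2 e, (0 < e)%N & derived [set: G] (t ^+ e)%g) ->
  generated (derived [set: G] `|` range x `|` [set` ts]) = [set: G] ->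
  ab_split G.
Proof.
elim: n x ts => [|n IHn] x ts tsX genG.
  by apply: (independent_ab_split tsX genG) => v _ [].
have [ind|] := pselect (forall v, comb x v = 0 -> forall i, v i = 0).
  exact: (independent_ab_split tsX genG ind).
move=> dep; have [v [i [vi v0]]] : exists v i, v i <> 0 /\ comb x v = 0.
  apply: contrapT => no; apply: dep => v v0 i; apply: contrapT => vi.
  by apply: no; exists v, i.
have [y [m [m0 ym yx]]] := relation_torsion (ex_intro _ i vi) v0.
apply: (IHn (fun i => y (fintype.lift ord0 i)) (y ord0 :: ts)) => [t|].
  rewrite inE => /predU1P[->|/tsX //]; exists `|m|%N.
    by rewrite absz_gt0; apply/eqP.
  apply/ab_eq0; rewrite abX; case: m m0 ym => k // _ /=.
  by rewrite NegzE mulrNz => /eqP; rewrite oppr_eq0 => /eqP.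
set A := (X in generated X); have gU := generated_subgroup A.
have DU : derived [set: G] `<=` generated A.
  by move=> g Dg; apply: sub_generated; left; left.
apply/seteqP; split=> // g _.
have : generated (derived [set: G] `|` range x `|` [set` ts]) g by rewrite genG.
apply: (generated_min gU) => {}g [[|[j _ <-]]|/= gts]; first exact: DU.
  have [c xc] := yx j; apply: (comb_in gU DU _ xc) => k.
  apply: sub_generated; case: (unliftP ord0 k) => [k' ->|->].
    by left; right; exists k'.
  by right; rewrite /= inE eqxx.
by apply: sub_generated; right; rewrite /= inE gts orbT.
Qed.

End FinitelyGenerated.

Lemma finitely_generated_ab_split (G : groupType) :
  finitely_generated G -> ab_split G.
Proof.
case=> k [s sG]; apply: (@generators_ab_split G k s [::]) => //.
apply/seteqP; split=> // g _.
have : generated (range s) g by rewrite sG.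
apply: generated_min; first exact: generated_subgroup.
by move=> h sh; apply: sub_generated; left; right.
Qed.

Lemma finitely_generated_countable (G : groupType) :
  finitely_generated G -> countable [set: G].
Proof.
case=> k [s sG].
pose letter (p : 'I_k * bool) := if p.2 then (s p.1)^-1 else s p.1.
pose ev (w : seq ('I_k * bool)) : G := \prod_(p <- w) letter p.
suff /choice[f fK] : forall g, exists w, ev w = g.
  apply/countable_injP; exists (pickle \o f) => g h _ _ /=.
  move/(pcan_inj pickleK) => E.
  by rewrite -(fK g) E.
have evV w : ev (rev [seq (p.1, ~~ p.2) | p <- w]) = (ev w)^-1.
  elim: w => [|[i b] w IHw]; first by rewrite /ev !big_nil invg1.
  rewrite /= rev_cons -cats1 /ev big_cat big_seq1 big_cons invgM -IHw.
  by congr (_ * _); rewrite /letter; case: b; rewrite //= invgK.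
have gE : is_subgroup (range ev).
  apply/subgroupP; split; first by exists [::]; rewrite // /ev big_nil.
  move=> _ _ [u _ <-] [v _ <-].
  exists (u ++ rev [seq (p.1, ~~ p.2) | p <- v]) => //.
  by rewrite -evV /ev big_cat.
have sE : range s `<=` range ev.
  by move=> _ [i _ <-]; exists [:: (i, false)] => //; rewrite /ev big_seq1.
move=> g; have : generated (range s) g by rewrite sG.
by case/(generated_min gE sE) => w _ <-; exists w.
Qed.

(** * The embedding theorem *)

Theorem corollary4 (M : groupType -> Prop) (hM : variety M) :
  (forall G : groupType, M G -> countable [set: G] ->
     free_abelian_times_finite (abelianization G) ->
     exists H : groupType,
       [/\ k_generated 4 H, product_variety M abelian_groups H & embeds G H])
  /\
  (forall G : groupType, M G -> finitely_generated G ->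
     exists H : groupType,
       [/\ k_generated 4 H, product_variety M abelian_groups H & embeds G H])
  /\
  (forall (l : nat) (G : groupType), countable [set: G] ->
     solvable_of_length l G ->
     free_abelian_times_finite (abelianization G) ->
     exists H : groupType,
       [/\ k_generated 4 H, solvable_of_length l.+1 H & embeds G H])
  /\
  (forall (l : nat) (G : groupType), finitely_generated G ->
     solvable_of_length l G ->
     exists H : groupType,
       [/\ k_generated 4 H, solvable_of_length l.+1 H & embeds G H]).
Proof.
split; [|split; [|split]].
- move=> G MG cG /free_times_finite_ab_split sG.
  by have [H [Hk GH HM _]] := ab_split_embedding cG sG; exists H; split; auto.
- move=> G MG fG; have sG := finitely_generated_ab_split fG.
  have cG := finitely_generated_countable fG.
  by have [H [Hk GH HM _]] := ab_split_embedding cG sG; exists H; split; auto.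
- move=> l G cG Gl /free_times_finite_ab_split sG.
  by have [H [Hk GH _ Hl]] := ab_split_embedding cG sG; exists H; split; auto.
- move=> l G fG Gl; have sG := finitely_generated_ab_split fG.
  have cG := finitely_generated_countable fG.
  by have [H [Hk GH _ Hl]] := ab_split_embedding cG sG; exists H; split; auto.
Qed.
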